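(* Let $\mathbb{K}$ be an infinite field and let $n\ge 2d$. Suppose $\pi$ is the cyclic permutation $\pi(i)=i+1$ for $i<n$ and $\pi(n)=1$, and let $t$ be an integer. Then $\operatorname{USP}(\mathcal{C}(V),\pi^t)$ holds for $V$ generic $n\times d$ Toeplitz, if and only if $t\ge d/2$.
   Context: A permutation $\sigma$ of $\{1,\dots,n\}$ is viewed as the coordinate permutation of $\mathbb{K}^n$ sending the standard basis vector $e_i$ to $e_{\sigma(i)}$; $\pi^t$ is the $t$-th power of $\pi$ under composition. For a linear subspace $\mathcal{V}\subseteq\mathbb{K}^n$ and a coordinate permutation $\sigma$ of $\mathbb{K}^n$, the Unlabeled Sensing Property $\operatorname{USP}(\mathcal{V},\sigma)$ is the statement: for all $v_1,v_2\in\mathcal{V}$, if $v_1=\sigma(v_2)$ then $v_1=v_2$. $\mathcal{C}(V)$ is the column-space of $V$. A matrix is Toeplitz if its $(i,j)$ entry depends only on $i-j$. Let $\mathbb{T}_{n\times d}$ be the affine space of $n\times d$ Toeplitz matrices with entries in $\mathbb{K}$. A statement holds ''for $V$ generic Toeplitz'' if there is a dense Zariski-open subset $\mathscr{U}\subseteq\mathbb{T}_{n\times d}$ such that the statement holds for every $V\in\mathscr{U}$.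
   Formalization: The integer t is restricted to t ≠ 0 with -d/2 < t ≤ n - d/2 (one representative of each class mod n, identity excluded); for arbitrary t the claim is false, e.g. at t = 0 with d ≥ 1, where π^0 is the identity and USP holds, or at t = n-1 with d ≥ 3. *)

(* Defs.v *)
From mathcomp Require Import all_boot all_order all_fingroup all_algebra.
From mathcomp Require Export mpoly.

Set Implicit Arguments.
Unset Strict Implicit.
Unset Printing Implicit Defensive.

Import GRing.Theory.
Local Open Scope ring_scope.

Definition infinite_field (K : fieldType) : Prop :=
  forall s : seq K, exists x : K, x \notin s.

(* Subtraction is in int: a diagonal is a signed difference of indices. *)
Definition toeplitz (K : fieldType) (n d : nat) (V : 'M[K]_(n, d)) : Prop :=
  forall (i i' : 'I_n) (j j' : 'I_d),
    i%:Z - j%:Z = i'%:Z - j'%:Z -> V i j = V i' j'.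

Definition mx_eval (K : fieldType) (n d : nat)
    (p : {mpoly K[(n * d)%N]}) (V : 'M[K]_(n, d)) : K :=
  p.@[fun k => mxvec V 0 k].

(* U is an open subset of T for the Zariski topology induced by the space of
   all n x d matrices: the complement in T of the common zero locus of a
   (possibly infinite) set S of polynomials in the n * d matrix entries.  When
   T is a linear subspace, these restrict to all polynomial functions on T, so
   this is the Zariski topology of the affine space T itself. *)
Definition zariski_open_in (K : fieldType) (n d : nat)
    (T U : 'M[K]_(n, d) -> Prop) : Prop :=
  (forall V, U V -> T V) /\
  exists S : {mpoly K[(n * d)%N]} -> Prop,
    forall V, T V -> (U V <-> exists p, S p /\ mx_eval p V != 0).

Definition zariski_dense_in (K : fieldType) (n d : nat)
    (T U : 'M[K]_(n, d) -> Prop) : Prop :=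
  forall W : 'M[K]_(n, d) -> Prop,
    zariski_open_in T W -> (exists V, W V) -> exists V, W V /\ U V.

Definition generic_in (K : fieldType) (n d : nat)
    (T P : 'M[K]_(n, d) -> Prop) : Prop :=
  exists U : 'M[K]_(n, d) -> Prop,
    [/\ zariski_open_in T U, zariski_dense_in T U & forall V, U V -> P V].

(* The i-th entry of the image of v is the (s^-1 i)-th entry of v, so that e_i
   is sent to e_(s i); see coord_perm_delta. *)
Definition coord_perm (K : fieldType) (n : nat) (s : 'S_n) (v : 'cV[K]_n) :
  'cV[K]_n := row_perm s^-1%g v.

Lemma coord_perm_delta (K : fieldType) (n : nat) (s : 'S_n) (i : 'I_n) :
  coord_perm s (delta_mx i 0 : 'cV[K]_n) = delta_mx (s i) 0.
Proof.
apply/matrixP=> k l; rewrite !mxE; congr ((_ && _)%:R).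
by rewrite -(inj_eq (@perm_inj _ s)) permKV.
Qed.

Definition USP (K : fieldType) (n : nat) (W : {vspace 'cV[K]_n}) (s : 'S_n) :
  Prop :=
  forall v1 v2 : 'cV[K]_n,
    v1 \in W -> v2 \in W -> v1 = coord_perm s v2 -> v1 = v2.

Definition colspace (K : fieldType) (n d : nat) (V : 'M[K]_(n, d)) :
  {vspace 'cV[K]_n} := <<[seq col j V | j : 'I_d]>>%VS.

(* With indices 0, ..., n-1: i goes to i + 1 modulo n. *)
Definition cyc_perm (n : nat) : 'S_n := perm (@ordS_inj n).

(* Negz m is the integer -(m + 1). *)
Definition perm_zpow (n : nat) (s : 'S_n) (t : int) : 'S_n :=
  match t with
  | Posz m => (s ^+ m)%g
  | Negz m => (s ^- m.+1)%g
  end.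

(* Main.v *)
Require Import Defs.
From mathcomp Require Import all_boot all_order all_fingroup all_algebra.
From mathcomp Require Import zify lra.
Import GRing.Theory Num.Theory.
Local Open Scope ring_scope.

Set Implicit Arguments.
Unset Strict Implicit.

(** Write P for the cyclic shift by m and a_(i-j) for the entries of V.

    Suppose 2m < d.  If x is y moved down by m places, with the last m entries
    of y equal to 0, then the Toeplitz structure makes V x and P V y agree in
    every row that the shift does not wrap around.  The m remaining rows impose
    m linear conditions on d - m > m unknowns, so some nonzero y satisfies
    them.  When V is injective, USP would force x = y, and a vector equal to a
    shift of itself by m > 0 places, filled with zeros, vanishes.  Injective
    Toeplitz matrices form a nonempty open set, hence meet every dense open set,
    so USP is not generic ([not_generic_USP_small_shift]).

    Suppose d <= 2m and m + d <= n.  If the n x 2d matrix [V | P V] has full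
    column rank, then V x = P V y already forces x = y = 0
    ([USP_of_row_full]).  Full column rank is the nonvanishing of some minor, a
    polynomial in the entries of V, so over an infinite field it is generic as
    soon as one Toeplitz matrix has it; [two_diagonals] is such a matrix
    ([two_diagonals_shift_row_full]).

    USP is invariant under inversion of the permutation.  This turns a negative
    exponent into a positive one, and an exponent m with m + d > n into n - m,
    which lies in the range just treated. *)

(** * Full column rank as a Zariski-open condition *)

(** In the row-vector conventions of the rank library, [row_full A] says that
    the column vectors have trivial kernel under [A]. *)
Lemma row_fullPn (K : fieldType) (m n : nat) (A : 'M[K]_(m, n)) :
  reflect (exists2 u : 'cV[K]_n, u != 0 & A *m u = 0) (~~ row_full A).
Proof.
have -> : row_full A = row_free A^T by rewrite /row_full /row_free mxrank_tr.
rewrite -kermx_eq0.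
apply: (iffP (@rowV0Pn _ _ _ (kermx A^T))) => [[v /sub_kermxP vA v0]|[u u0 Au]].
  exists v^T; first by rewrite trmx_eq0.
  by apply: (can_inj (@trmxK _ _ _)); rewrite trmx_mul trmxK vA trmx0.
exists u^T; last by rewrite trmx_eq0.
by apply/sub_kermxP; rewrite -trmx_mul Au trmx0.
Qed.

Lemma row_full_inj (K : fieldType) (m n : nat) (A : 'M[K]_(m, n))
    (u : 'cV[K]_n) : row_full A -> A *m u = 0 -> u = 0.
Proof.
by case/row_fullP=> B BA Au; rewrite -[u]mul1mx -BA -mulmxA Au mulmx0.
Qed.

Lemma minor_poly (K : fieldType) (n d k : nat)
    (f : 'I_k -> 'I_k -> 'I_n) (g : 'I_k -> 'I_k -> 'I_d) :
  exists p : {mpoly K[(n * d)%N]}, forall V : 'M[K]_(n, d),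
    mx_eval p V = \det (\matrix_(i, j) V (f i j) (g i j)).
Proof.
exists (\det (\matrix_(i, j) 'X_(mxvec_index (f i j) (g i j)))) => V.
rewrite /mx_eval -det_map_mx; congr (\det _).
by apply/matrixP=> i j; rewrite !mxE /= mevalXU mxvecE.
Qed.

(** The nonvanishing of one fixed maximal minor, chosen nonzero at [V0],
    witnesses that full column rank is an open condition.  Describing [F] by
    index maps covers both [V] itself and [V] next to a row permutation of it. *)
Lemma row_full_poly (K : fieldType) (n d N k : nat)
    (f : 'I_N -> 'I_k -> 'I_n) (g : 'I_N -> 'I_k -> 'I_d)
    (F := fun V : 'M[K]_(n, d) => \matrix_(i, j) V (f i j) (g i j))
    (V0 : 'M[K]_(n, d)) :
  row_full (F V0) ->
  exists2 p, mx_eval p V0 != 0 & forall V, mx_eval p V != 0 -> row_full (F V).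
Proof.
move=> full0; set r := fullrankfun full0.
have [p pE] := minor_poly K (fun i j => f (r i) j) (fun i j => g (r i) j).
have {}pE V : mx_eval p V = \det (rowsub r (F V)).
  by rewrite pE; congr (\det _); apply/matrixP=> i j; rewrite !mxE.
exists p => [|V]; first by rewrite pE -unitfE; apply: fullrowsub_unit.
rewrite pE => detV; apply: contraNT detV => /row_fullPn[u u0 Fu].
rewrite -det_tr; apply/det0P; exists u^T; first by rewrite trmx_eq0.
by rewrite -trmx_mul mul_rowsub_mx Fu; apply/matrixP=> i j; rewrite !mxE.
Qed.

(** * Generic properties over an infinite field *)

Lemma infinite_field_nonroot (K : fieldType) (hK : infinite_field K)
    (u : {poly K}) : u != 0 -> exists x, u.[x] != 0.
Proof.
move=> u0.
have [s us ss] : exists2 s : seq K, uniq s & size s = size u.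
  elim: (size u) => [|k [s us ss]]; first by exists [::].
  by have [x xs] := hK s; exists (x :: s); rewrite /= ?xs ?ss.
have [sr|/allPn[x _ xr]] := boolP (all (root u) s); last by exists x.
by have := max_poly_roots u0 sr us; rewrite ss ltnn.
Qed.

(** Restricting to lines reduces statements about several variables, and about
    an arbitrary linear family of matrices, to the finiteness of the set of
    roots of a polynomial in one variable. *)
Lemma mx_eval_line (K : fieldType) (n d : nat) (p : {mpoly K[(n * d)%N]})
    (V W : 'M[K]_(n, d)) :
  exists u : {poly K}, forall s, u.[s] = mx_eval p (V + s *: (W - V)).
Proof.
exists (\sum_(m <- msupp p) (p@_m)%:P * \prod_i
  ((mxvec V 0 i)%:P + 'X * (mxvec (W - V) 0 i)%:P) ^+ m i) => s.
rewrite /mx_eval mevalE horner_sum; apply: eq_bigr => m _.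
rewrite hornerM hornerC horner_prod; congr (_ * _); apply: eq_bigr => i _.
by case/mxvec_indexP: i => a b; rewrite !hornerE !mxvecE !mxE.
Qed.

Definition line_closed (K : fieldType) (n d : nat) (T : 'M[K]_(n, d) -> Prop) :=
  forall V W s, T V -> T W -> T (V + s *: (W - V)).

(** Irreducibility of an affine space over an infinite field: on the line from
    [V] to [W] both polynomials restrict to nonzero ones, hence so does their
    product. *)
Lemma line_closed_meet (K : fieldType) (hK : infinite_field K) (n d : nat)
    (T : 'M[K]_(n, d) -> Prop) (hT : line_closed T)
    (p q : {mpoly K[(n * d)%N]}) (V W : 'M[K]_(n, d)) :
  T V -> T W -> mx_eval p V != 0 -> mx_eval q W != 0 ->
  exists Z, [/\ T Z, mx_eval p Z != 0 & mx_eval q Z != 0].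
Proof.
move=> TV TW pV qW; have [u uE] := mx_eval_line p V W.
have [v vE] := mx_eval_line q V W.
have u0 : u != 0.
  by apply: contraNneq pV => u0; have := uE 0; rewrite u0 horner0 scale0r addr0 => <-.
have v0 : v != 0.
  apply: contraNneq qW => v0; have := vE 1.
  by rewrite v0 horner0 scale1r addrC subrK => <-.
have [|s] := @infinite_field_nonroot K hK (u * v); first by rewrite mulf_neq0.
rewrite hornerM mulf_eq0 negb_or uE vE => /andP[us vs].
by exists (V + s *: (W - V)); split=> //; apply: hT.
Qed.

Lemma generic_in_of_poly (K : fieldType) (hK : infinite_field K) (n d : nat)
    (T P : 'M[K]_(n, d) -> Prop) (hT : line_closed T)
    (p : {mpoly K[(n * d)%N]}) (V0 : 'M[K]_(n, d)) :
  T V0 -> mx_eval p V0 != 0 ->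
  (forall V, T V -> mx_eval p V != 0 -> P V) -> generic_in T P.
Proof.
move=> TV0 pV0 hP; exists (fun V => T V /\ mx_eval p V != 0).
split=> [|W [WT [S WS]] [V1 WV1]|V []]; last exact: hP.
  split=> [V []//|]; exists (eq p) => V TV.
  by split=> [[_ pV]|[_ [<- pV]]]; [exists p | split].
have TV1 := WT _ WV1; have [q [Sq qV1]] := (WS _ TV1).1 WV1.
have [Z [TZ pZ qZ]] := line_closed_meet hK hT TV0 TV1 pV0 qV1.
by exists Z; split; [apply/(WS _ TZ); exists q | split].
Qed.

Lemma generic_in_meets (K : fieldType) (n d : nat)
    (T P : 'M[K]_(n, d) -> Prop) (p : {mpoly K[(n * d)%N]}) (V0 : 'M[K]_(n, d)) :
  generic_in T P -> T V0 -> mx_eval p V0 != 0 ->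
  exists V, [/\ T V, P V & mx_eval p V != 0].
Proof.
move=> [U [_ dU UP]] TV0 pV0.
have [||V [[TV pV] UV]] := dU (fun V => T V /\ mx_eval p V != 0).
- split=> [V []//|]; exists (eq p) => V TV.
  by split=> [[_ pV]|[_ [<- pV]]]; [exists p | split].
- by exists V0.
by exists V; split=> //; apply: UP.
Qed.

Lemma toeplitz_line_closed (K : fieldType) (n d : nat) :
  line_closed (@toeplitz K n d).
Proof.
move=> V W s TV TW i i' j j' e.
by rewrite !mxE (TV _ _ _ _ e) (TW _ _ _ _ e).
Qed.

(** * Unlabeled sensing and the cyclic permutation *)

Lemma colspaceP (K : fieldType) (n d : nat) (V : 'M[K]_(n, d)) (v : 'cV[K]_n) :
  (v \in colspace V) <-> exists x : 'cV[K]_d, v = V *m x.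
Proof.
split=> [|[x ->]]; last first.
  have -> : V *m x = \sum_j x j 0 *: col j V.
    apply/matrixP=> i k; rewrite ord1 !mxE summxE.
    by apply: eq_bigr => j _; rewrite !mxE mulrC.
  apply: memv_suml => j _; apply: memvZ; apply: memv_span.
  by apply/imageP; exists j.
have sub : (colspace V <= limg (linfun (mulmx V : 'cV[K]_d -> 'cV[K]_n)))%VS.
  apply/span_subvP=> _ /imageP[j _ ->]; rewrite colE.
  by apply/memv_imgP; exists (delta_mx j 0); rewrite ?memvf ?lfunE.
by move/(subvP sub)/memv_imgP=> [x _ ->]; exists x; rewrite lfunE.
Qed.

Lemma USP_inv (K : fieldType) (n : nat) (W : {vspace 'cV[K]_n}) (s : 'S_n) :
  USP W s -> USP W s^-1%g.
Proof.
move=> h v1 v2 v1W v2W e; apply/esym/h => //.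
by rewrite e /coord_perm -row_permM invgK mulVg row_perm1.
Qed.

Lemma USP_invE (K : fieldType) (n : nat) (W : {vspace 'cV[K]_n}) (s : 'S_n) :
  USP W s^-1%g <-> USP W s.
Proof. by split=> /USP_inv; rewrite ?invgK. Qed.

Lemma USP_of_row_full (K : fieldType) (n d : nat) (V : 'M[K]_(n, d)) (s : 'S_n) :
  row_full (row_mx V (row_perm s^-1%g V)) -> USP (colspace V) s.
Proof.
move=> full _ _ /colspaceP[x ->] /colspaceP[y ->] e.
have : row_mx V (row_perm s^-1%g V) *m col_mx x (- y) = 0.
  rewrite mul_row_col mulmxN e /coord_perm.
  by rewrite ![row_perm _ _]row_permE mulmxA subrr.
move/(row_full_inj full)/eqP; rewrite col_mx_eq0 oppr_eq0.
by case/andP=> /eqP-> /eqP->.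
Qed.

Lemma cyc_permX (n m : nat) (i : 'I_n) :
  ((cyc_perm n ^+ m)%g i : nat) = ((i + m) %% n)%N.
Proof.
elim: m => [|m IHm]; first by rewrite expg0 perm1 addn0 modn_small.
by rewrite expgSr permM permE /= IHm addnS -addn1 modnDml addn1.
Qed.

Lemma cyc_permX_order (n : nat) : (cyc_perm n ^+ n = 1)%g.
Proof.
by apply/permP=> i; apply: val_inj; rewrite /= cyc_permX perm1 modnDr modn_small.
Qed.

Lemma cyc_permXV (n m : nat) (i : 'I_n) : (m <= n)%N ->
  (((cyc_perm n ^+ m)^-1)%g i : nat) = (if m <= i then i - m else i + n - m)%N.
Proof.
move=> mn; have -> : ((cyc_perm n ^+ m)^-1 = cyc_perm n ^+ (n - m))%g.
  by apply/esym/(mulIg (cyc_perm n ^+ m)%g); rewrite mulVg -expgD subnK ?cyc_permX_order.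
rewrite cyc_permX addnBA //; have iln := ltn_ord i.
case: leqP => [mi|im]; last by rewrite modn_small //; lia.
by rewrite -addnBAC // modnDr modn_small //; lia.
Qed.

(** * Small shifts: failure on every injective Toeplitz matrix *)

(** Here [g] and [f] embed the d - m unknowns [u] as the last and the first
    coordinates of K^d, giving [x] and [y]; [D *m u = 0] expresses the equality
    of [V x] and the shift of [V y] in the m rows reached by wrapping around. *)
Lemma not_USP_small_shift (K : fieldType) (n d m : nat) (V : 'M[K]_(n, d)) :
  (2 * d <= n)%N -> (0 < m)%N -> (2 * m < d)%N ->
  toeplitz V -> row_full V -> ~ USP (colspace V) (cyc_perm n ^+ m)%g.
Proof.
move=> hnd m0 md TV Vfull usp.
have fP (l : 'I_(d - m)) : (l < d)%N by have := ltn_ord l; lia.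
have gP (l : 'I_(d - m)) : (l + m < d)%N by have := ltn_ord l; lia.
have topP (i : 'I_m) : (i < n)%N by have := ltn_ord i; lia.
have botP (i : 'I_m) : (n - m + i < n)%N by have := ltn_ord i; lia.
pose f l := Ordinal (fP l); pose g l := Ordinal (gP l).
pose top i := Ordinal (topP i); pose bot i := Ordinal (botP i).
pose D := rowsub top (colsub g V) - rowsub bot (colsub f V).
have [u u0 Du] : exists2 u : 'cV[K]_(d - m), u != 0 & D *m u = 0.
  by apply/row_fullPn; rewrite /row_full; have := rank_leq_row D; lia.
pose x := colsub g 1%:M *m u; pose y := colsub f 1%:M *m u.
have Vx : V *m x = colsub g V *m u by rewrite mulmxA mulmx_colsub mulmx1.
have Vy : V *m y = colsub f V *m u by rewrite mulmxA mulmx_colsub mulmx1.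
have shift : V *m x = coord_perm (cyc_perm n ^+ m)%g (V *m y).
  apply/matrixP=> r c; rewrite ord1 /coord_perm [RHS]mxE.
  set i := (cyc_perm n ^+ m)^-1%g r; have -> : r = (cyc_perm n ^+ m)%g i by rewrite permKV.
  rewrite Vx Vy; have := cyc_permX m i; set r' := (cyc_perm n ^+ m)%g i => r'E.
  have [im|im] := ltnP (i + m) n.
    rewrite !mxE; apply: eq_bigr => l _; rewrite !mxE; congr (_ * _).
    by apply: TV; rewrite r'E modn_small //=; lia.
  have i'P : (i + m - n < m)%N by have := ltn_ord i; lia.
  pose i' := Ordinal i'P.
  have -> : r' = top i'.
    apply: val_inj; rewrite /= r'E -[in LHS](subnK im) modnDr modn_small //.
    by have := ltn_ord i; lia.
  have -> : i = bot i' by apply: val_inj => /=; have := ltn_ord i; lia.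
  have /matrixP/(_ i' 0) := Du; rewrite mulmxBl !mul_rowsub_mx !mxE.
  by move/eqP; rewrite subr_eq0 => /eqP; under eq_bigr do rewrite mxE;
     under [X in _ = X]eq_bigr do rewrite mxE; move=> ->.
have {}shift : V *m x = V *m y.
  by apply: usp shift; apply/colspaceP; [exists x | exists y].
have xy : x = y.
  apply/eqP; rewrite -subr_eq0; apply/eqP/(row_full_inj Vfull).
  by rewrite mulmxBr shift subrr.
(* Entry l of x = y reads u_l = u_(l - m), or u_l = 0 when l < m. *)
case/eqP: u0; apply/matrixP=> l c; rewrite ord1 {c} mxE.
have [k] := ubnP (val l); elim: k l => // k IH l lk.
have yE : y (f l) 0 = u l 0.
  rewrite mxE (bigD1 l) //= big1 ?addr0 => [|j jl]; rewrite !mxE.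
    by rewrite eqxx mul1r.
  rewrite (_ : (_ == _) = false) ?mul0r //; apply/negbTE; apply: contraNneq jl.
  by move/(congr1 val)=> /= e; apply/eqP/val_inj.
rewrite -yE -xy mxE big1 // => j _; rewrite !mxE.
have [/(congr1 val)/= e|_] := eqVneq (f l) (g j); last by rewrite mul0r.
by rewrite mul1r IH //; move: lk => /=; lia.
Qed.

(** * Large shifts: a Toeplitz matrix in general position with its shift *)

(** For m < d, column j is e_(j+d-m), plus e_(j-m) when m <= j.  The main
    diagonal would be the simplest choice, and is what remains when d <= m, but
    for m < d the columns of the identity overlap with their shifts.  Moving the
    diagonal down by d - m leaves the first d - m rows free to carry the second
    diagonal, which separates the d - m columns that overlap. *)
Definition two_diagonals (K : fieldType) (n d m : nat) : 'M[K]_(n, d) :=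
  \matrix_(i, j) ((i == j + (d - m) :> nat)%N%:R + (i + m == j :> nat)%N%:R).

Lemma two_diagonals_toeplitz (K : fieldType) (n d m : nat) :
  toeplitz (two_diagonals K n d m).
Proof.
move=> i i' j j' e; rewrite !mxE.
by congr (_%:R + _%:R); congr nat_of_bool; apply/eqP/eqP; lia.
Qed.

(** Reading coordinates beyond d as 0 turns both products below into sums of
    shifted copies of one sequence, with no case analysis at the border. *)
Definition zero_ext (K : fieldType) (d : nat) (x : 'cV[K]_d) (k : nat) : K :=
  oapp (fun j => x j 0) 0 (insub k).

Lemma zero_extE (K : fieldType) (d : nat) (x : 'cV[K]_d) (j : 'I_d) :
  zero_ext x j = x j 0.
Proof. by rewrite /zero_ext valK. Qed.

Lemma zero_ext_ge (K : fieldType) (d : nat) (x : 'cV[K]_d) (k : nat) :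
  (d <= k)%N -> zero_ext x k = 0.
Proof. by move=> dk; rewrite /zero_ext insubN // -leqNgt. Qed.

Lemma sum_zero_ext (K : fieldType) (d : nat) (x : 'cV[K]_d) (k : nat) :
  \sum_(j < d) (k == j :> nat)%:R * x j 0 = zero_ext x k.
Proof.
have [dk|kd] := leqP d k.
  rewrite zero_ext_ge // big1 // => j _.
  by rewrite gtn_eqF ?mul0r // (leq_trans (ltn_ord j)).
rewrite (bigD1 (Ordinal kd)) //= eqxx mul1r big1 ?addr0 => [|j jk].
  by rewrite -(zero_extE x (Ordinal kd)).
by rewrite (_ : (_ == _) = false) ?mul0r // eq_sym; apply/negbTE.
Qed.

Lemma two_diagonals_mul (K : fieldType) (n d m : nat) (x : 'cV[K]_d) (i : 'I_n) :
  (two_diagonals K n d m *m x) i 0 =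
  (if (d - m <= i)%N then zero_ext x (i - (d - m)) else 0) +
  zero_ext x (i + m).
Proof.
rewrite mxE; under eq_bigr do rewrite mxE mulrDl.
rewrite big_split /= sum_zero_ext; congr (_ + _).
case: leqP => h; last first.
  by rewrite big1 // => j _; rewrite ltn_eqF ?mul0r //; lia.
rewrite -sum_zero_ext; apply: eq_bigr => j _.
by congr (_%:R * _); congr nat_of_bool; apply/eqP/eqP; lia.
Qed.

(** A kernel vector (x, y) is eliminated one band of rows at a time: rows below
    d - m involve only the entries of x from m on; once these vanish, the rows
    from max(d, m) on give y = 0, and the rows from d - m on give x = 0. *)
Lemma two_diagonals_shift_row_full (K : fieldType) (n d m : nat) :
  (2 * d <= n)%N -> (0 < m)%N -> (d <= 2 * m)%N -> (m + d <= n)%N ->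
  row_full (row_mx (two_diagonals K n d m)
    (row_perm (cyc_perm n ^+ m)^-1%g (two_diagonals K n d m))).
Proof.
move=> hnd m0 dm mdn; apply/idPn => /row_fullPn[z z0].
rewrite -[z]vsubmxK mul_row_col; set x := usubmx z; set y := dsubmx z => e.
have {}e (r : nat) : (r < n)%N ->
    (if (d - m <= r)%N then zero_ext x (r - (d - m)) else 0)
    + zero_ext x (r + m)
    + (if (m <= r)%N then
        (if (d - m <= r - m)%N then zero_ext y (r - m - (d - m)) else 0)
        + zero_ext y r
      else 0) = 0.
  move=> rn; pose i := Ordinal rn.
  have /matrixP/(_ i 0) := e; rewrite mxE [RHS]mxE => sum0; rewrite -[RHS]sum0.
  rewrite two_diagonals_mul row_permE -mulmxA -row_permE mxE two_diagonals_mul.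
  congr (_ + _); rewrite cyc_permXV /=; last by lia.
  case: (leqP m r) => mr; first by rewrite subnK.
  (* The rows wrapped around by the shift come from the last m rows of the
     matrix, which vanish because m + d <= n and 2d <= n. *)
  by rewrite !zero_ext_ge ?if_same ?addr0 //; lia.
have x_high k : (m <= k)%N -> zero_ext x k = 0.
  move=> mk; have [dk|kd] := leqP d k; first exact: zero_ext_ge.
  have := e (k - m)%N; rewrite subnK // ifN; last by lia.
  by rewrite ifN ?add0r ?addr0; [apply | ]; lia.
have y0 k : zero_ext y k = 0.
  have [dk|kd] := leqP d k; first exact: zero_ext_ge.
  have := e (k + (d - m) + m)%N.
  rewrite !addnK leq_addl leq_addl ifT; last by lia.
  rewrite x_high ?x_high ?add0r; try lia.
  by rewrite [zero_ext y (_ + _ + _)]zero_ext_ge ?addr0; [apply | ]; lia.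
have x0 k : zero_ext x k = 0.
  have [dk|kd] := leqP d k; first exact: zero_ext_ge.
  have := e (k + (d - m))%N; rewrite addnK leq_addl !y0 !if_same addr0 if_same addr0.
  by rewrite [zero_ext x (_ + _)]x_high ?addr0; [apply | ]; lia.
case/eqP: z0; rewrite -[z]vsubmxK -/x -/y.
apply/eqP; rewrite col_mx_eq0; apply/andP.
by split; apply/eqP/matrixP=> j c; rewrite ord1 -zero_extE ?x0 ?y0 mxE.
Qed.

(** * The dichotomy *)

Lemma generic_USP_shift (K : fieldType) (hK : infinite_field K) (n d m : nat) :
  (2 * d <= n)%N -> (0 < m)%N -> (d <= 2 * m)%N -> (m + d <= n)%N ->
  generic_in (@toeplitz K n d)
    (fun V => USP (colspace V) (cyc_perm n ^+ m)%g).
Proof.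
move=> hnd m0 dm mdn; set s := (cyc_perm n ^+ m)%g.
pose f (i : 'I_n) (j : 'I_(d + d)) :=
  if split j is inl _ then i else (s^-1)%g i.
pose g (i : 'I_n) (j : 'I_(d + d)) :=
  match split j with inl j1 => j1 | inr j2 => j2 end.
have FE (V : 'M[K]_(n, d)) :
    row_mx V (row_perm s^-1%g V) = \matrix_(i, j) V (f i j) (g i j).
  by apply/matrixP=> i j; rewrite !mxE /f /g; case: split => k //; rewrite mxE.
have := two_diagonals_shift_row_full K hnd m0 dm mdn.
rewrite FE => /(row_full_poly (f := f) (g := g))[p p0 pfull].
apply: (generic_in_of_poly hK (@toeplitz_line_closed K n d)
  (V0 := two_diagonals K n d m)) p0 _ => // [|V _ pV]; first exact: two_diagonals_toeplitz.
by apply: USP_of_row_full; rewrite FE; apply: pfull.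
Qed.

Lemma generic_toeplitz_row_full (K : fieldType) (n d : nat)
    (P : 'M[K]_(n, d) -> Prop) :
  (d <= n)%N -> generic_in (@toeplitz K n d) P ->
  exists V, [/\ toeplitz V, P V & row_full V].
Proof.
move=> dn gen.
have full0 : row_full (pid_mx d : 'M[K]_(n, d)).
  by rewrite /row_full rank_pid_mx.
have FE (V : 'M[K]_(n, d)) : V = \matrix_(i, j) V i j.
  by apply/matrixP=> i j; rewrite mxE.
move: (full0); rewrite (FE (pid_mx d)).
move=> /(row_full_poly (f := fun i _ => i) (g := fun _ j => j))[p p0 pfull].
have T0 : toeplitz (pid_mx d : 'M[K]_(n, d)).
  move=> i i' j j' e; rewrite !mxE; congr (_%:R); congr nat_of_bool.
  by have := ltn_ord j; have := ltn_ord j'; lia.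
have [V [TV PV pV]] := generic_in_meets gen T0 p0.
by exists V; split=> //; rewrite (FE V); apply: pfull.
Qed.

Lemma not_generic_USP_small_shift (K : fieldType) (n d m : nat) :
  (2 * d <= n)%N -> (0 < m)%N -> (2 * m < d)%N ->
  ~ generic_in (@toeplitz K n d)
      (fun V => USP (colspace V) (cyc_perm n ^+ m)%g).
Proof.
move=> hnd m0 md /generic_toeplitz_row_full[|V [TV usp full]]; first by lia.
exact: not_USP_small_shift usp.
Qed.

Lemma generic_in_imply (K : fieldType) (n d : nat) (T P Q : 'M[K]_(n, d) -> Prop) :
  (forall V, P V -> Q V) -> generic_in T P -> generic_in T Q.
Proof. by move=> PQ [U [oU dU UP]]; exists U; split=> // V /UP/PQ. Qed.

Unset Implicit Arguments.

(* The exponent is normalised modulo n: the half-open window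
   ]- d / 2, n - d / 2] contains exactly one representative of every residue
   class, and t = 0, the identity permutation, is excluded. *)
Theorem proposition6 (K : fieldType) (hK : infinite_field K) (n d : nat)
  (hnd : (2 * d <= n)%N) (t : int) (ht0 : t != 0)
  (htl : - (d%:R / 2%:R) < t%:~R :> rat)
  (htu : t%:~R <= n%:R - d%:R / 2%:R :> rat) :
  generic_in (@toeplitz K n d)
    (fun V => USP (colspace V) (perm_zpow (cyc_perm n) t))
  <-> d%:R / 2%:R <= t%:~R :> rat.
Proof.
case: t ht0 htl htu => m m0 tl tu /=; last first.
  have md : (2 * m.+1 < d)%N.
    rewrite -(ltr_nat rat) natrM; move: tl; rewrite NegzE mulrNz -pmulrn; lra.
  split=> [gen|dt]; last first.
    exfalso; move: dt; rewrite NegzE mulrNz -pmulrn.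
    have : 0 <= d%:R :> rat by []. have : 0 < m.+1%:R :> rat by [].
    lra.
  case: (not_generic_USP_small_shift (K := K) (m := m.+1) hnd isT md).
  by apply: generic_in_imply gen => V /USP_invE.
have -> : (d%:R / 2%:R <= m%:~R :> rat) = (d <= 2 * m)%N.
  by rewrite -(ler_nat rat) natrM -pmulrn; apply/idP/idP; lra.
have {}tu : (2 * m + d <= 2 * n)%N.
  by rewrite -(ler_nat rat) natrD !natrM; move: tu; rewrite -pmulrn; lra.
have {}m0 : (0 < m)%N by rewrite lt0n; apply: contraNneq m0 => ->.
split=> [gen|dm].
  by rewrite leqNgt; apply/negP=> md; apply: not_generic_USP_small_shift gen.
have [mdn|mdn] := leqP (m + d) n; first exact: generic_USP_shift.
(* As m > n - d >= d, the exponent n - m is less than d <= n - d; the upper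
   bound of the window on m becomes the lower bound d / 2 on n - m. *)
have mn : (m <= n)%N by lia.
have -> : (cyc_perm n ^+ m = (cyc_perm n ^+ (n - m))^-1)%g.
  by apply/esym/(mulgI (cyc_perm n ^+ (n - m))%g);
     rewrite mulgV -expgD subnK ?cyc_permX_order.
apply: (generic_in_imply (P := fun V => USP (colspace V) (cyc_perm n ^+ (n - m))%g)).
  by move=> V usp; apply/USP_invE.
by apply: generic_USP_shift => //; lia.
Qed.
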